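(* Let $n\ge1$. Suppose that $N(n)=2n+q$ with $q\le n$, and that $n+q=2^r+m$ with $0\le m<2^r$ ($q,r,m$ integers). Then $q>m$, and hence $$2^r-q\le n\le 2^r-1 .$$ In particular, if moreover $n=2^\ell$, then $q=n$; consequently, for every integer $\ell\ge0$, $$N(2^\ell)\ge 3\cdot 2^\ell .$$
   Context: A pair of lines in $\mathbf{R}^N$ is skew if they are not parallel and do not intersect (in particular, two equal lines are not skew). A submanifold $M^n\subset\mathbf{R}^N$ (with $C^1$ regularity) is totally skew if every pair of (affine) tangent lines of $M$ is skew, unless they are tangent to $M$ at the same point. A ($C^1$) embedding is totally skew if its image is a totally skew submanifold. $N(n)$ denotes the smallest $N$ such that $\mathbf{R}^n$ admits a totally skew embedding in $\mathbf{R}^N$. *)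

(* Defs.v *)
From HB Require Import structures.
From mathcomp Require Import all_boot all_order all_algebra.
From mathcomp Require Import all_classical all_reals all_analysis.
Import Order.TTheory GRing.Theory Num.Theory.
Import numFieldNormedType.Exports.

Set Implicit Arguments.
Unset Strict Implicit.
Unset Printing Implicit Defensive.

Local Open Scope classical_set_scope.
Local Open Scope ring_scope.

(* C^1 on an open set U; f is a total function whose values outside U are
   irrelevant. *)
Definition C1_on (R : realType) (n N : nat) (U : set 'rV[R]_n)
    (f : 'rV[R]_n -> 'rV[R]_N) : Prop :=
  forall x, U x -> differentiable f x /\ {for x, continuous (jacobian f)}.

(* C^1 immersion of the open set U that is a homeomorphism onto f @` U, the
   inverse g being continuous for the subspace topology. *)
Definition C1_embedding_on (R : realType) (n N : nat) (U : set 'rV[R]_n)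
    (f : 'rV[R]_n -> 'rV[R]_N) : Prop :=
  [/\ C1_on U f,
      forall x, U x -> injective ('d f x) &
      exists g : 'rV[R]_N -> 'rV[R]_n,
        (forall x, U x -> g (f x) = x) /\ {within f @` U, continuous g}].

Definition submanifold (R : realType) (n N : nat) (M : set 'rV[R]_N) : Prop :=
  forall p, M p ->
    exists (U : set 'rV[R]_n) (W : set 'rV[R]_N) (phi : 'rV[R]_n -> 'rV[R]_N),
      [/\ open U, open W, W p, C1_embedding_on U phi & phi @` U = M `&` W].

(* Velocities at p of C^1 curves lying in M. *)
Definition tangent_vector (R : realType) (N : nat) (M : set 'rV[R]_N)
    (p v : 'rV[R]_N) : Prop :=
  exists gamma : R -> 'rV[R]_N,
    [/\ gamma 0 = p,
        \forall t \near (0 : R), [/\ M (gamma t), derivable gamma t 1 &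
                                     {for t, continuous (derive1 gamma)}] &
        derive1 gamma 0 = v].

Definition line (R : realType) (N : nat) (p v : 'rV[R]_N) : set 'rV[R]_N :=
  [set p + t *: v | t in [set: R]].

Definition tangent_line (R : realType) (N : nat) (M : set 'rV[R]_N)
    (p : 'rV[R]_N) (L : set 'rV[R]_N) : Prop :=
  exists v, [/\ tangent_vector M p v, v != 0 & L = line p v].

(* Intended for affine lines: one is a translate of the other; a line is
   parallel to itself. *)
Definition parallel (R : realType) (N : nat) (L1 L2 : set 'rV[R]_N) : Prop :=
  exists w : 'rV[R]_N, L2 = [set w + x | x in L1].

Definition skew (R : realType) (N : nat) (L1 L2 : set 'rV[R]_N) : Prop :=
  ~ parallel L1 L2 /\ L1 `&` L2 = set0.

Definition totally_skew (R : realType) (n N : nat) (M : set 'rV[R]_N) : Prop :=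
  submanifold n M /\
  forall p q (L1 L2 : set 'rV[R]_N), M p -> M q -> p != q ->
    tangent_line M p L1 -> tangent_line M q L2 -> skew L1 L2.

Definition admits_totally_skew_embedding (R : realType) (n N : nat) : Prop :=
  exists f : 'rV[R]_n -> 'rV[R]_N,
    C1_embedding_on [set: 'rV[R]_n] f /\ totally_skew n (range f).

(* The number N(n).  The default value 0 would be taken only if R^n admitted no
   totally skew embedding in any R^N. *)
Definition skew_dim (R : realType) (n : nat) : nat :=
  xget 0%N [set N : nat | admits_totally_skew_embedding R n N /\
    forall k, admits_totally_skew_embedding R n k -> (N <= k)%N].

(* Main.v *)
(* Write J for the Jacobian of a totally skew embedding f.  For x != y the map
   (u, v, t) |-> u J(x) + v J(y) + t (f x - f y) is injective; restricted to
   antipodal points x = y', y = - y' of a small sphere it becomes, modulo the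
   range of J(y') + J(- y'), a nowhere vanishing map S^i x S^n -> R^(N - n)
   that is odd in each variable, for every i < n.  By the Hopf-Stiefel theorem
   this forces N - n > n + i as soon as the binomial coefficient C(n + i, i) is
   odd; the choice n + i = 2^(r+1) - 1 gives all the claims.

   The Hopf-Stiefel theorem is proved by a Ky Fan count: each product of a
   p-cell and a q-cell of the two spheres is filled by a fine chain, and the
   number of its alternating simplices is C(p + q, p) mod 2, by Pascal's
   rule, whereas only N - n labels are available. *)

From HB Require Import structures.
Require Import Defs.
From mathcomp Require Import all_boot all_order all_algebra.
From mathcomp Require Import all_classical all_reals all_analysis.
From mathcomp Require Import perm ring lra zify.
Import Order.TTheory GRing.Theory Num.Theory.
Import numFieldNormedType.Exports.
Set Implicit Arguments.
Unset Strict Implicit.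
Unset Printing Implicit Defensive.

Local Open Scope nat_scope.

(** * Chains of tuples and Ky Fan's count *)

Section Chains.
Variable T : Type.
Implicit Types (F G : seq T -> bool) (c : seq (seq T)) (s : seq T).

(** A list of tuples stands for a chain mod 2. Chains are only ever tested against cochains [F], so
    that identities between chains are stated in dual form. *)
Definition pairing c F := \big[addb/false]_(s <- c) F s.

Fixpoint coboundary F s : bool :=
  if s is x :: s' then F s' (+) coboundary (fun r => F (x :: r)) s' else false.

Lemma eq_coboundary F G : F =1 G -> coboundary F =1 coboundary G.
Proof.
move=> FG s; elim: s F G FG => //= x s IH F G FG.
by rewrite FG; congr (_ (+) _); apply: IH => r; rewrite FG.
Qed.

Lemma coboundaryD F G s :
  coboundary (fun r => F r (+) G r) s = coboundary F s (+) coboundary G s.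
Proof. by elim: s F G => //= x s IH F G; rewrite IH addbACA. Qed.

(** The usual triangulation of a prism: the tuples [f x_0, ..., f x_i, g x_i, ..., g x_k], one for
    each [i]. *)
Fixpoint prism (f g : T -> T) s : seq (seq T) :=
  if s is x :: s' then (f x :: map g s) :: map (cons (f x)) (prism f g s')
  else [::].

Lemma pairing_cons s c F : pairing (s :: c) F = F s (+) pairing c F.
Proof. by rewrite /pairing big_cons. Qed.

Lemma pairing_nil F : pairing [::] F = false.
Proof. by rewrite /pairing big_nil. Qed.

Lemma pairing_cat c1 c2 F : pairing (c1 ++ c2) F = pairing c1 F (+) pairing c2 F.
Proof. by rewrite /pairing big_cat. Qed.

Lemma pairing_map (f : seq T -> seq T) c F :
  pairing (map f c) F = pairing c (F \o f).
Proof. by rewrite /pairing big_map. Qed.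

Lemma pairing_flatten (f : seq T -> seq (seq T)) c F :
  pairing (flatten (map f c)) F = pairing c (fun s => pairing (f s) F).
Proof.
elim: c => [|s c IH] /=; first by rewrite !pairing_nil.
by rewrite pairing_cat IH pairing_cons.
Qed.

Lemma pairingD c F G :
  pairing c (fun s => F s (+) G s) = pairing c F (+) pairing c G.
Proof. by rewrite /pairing big_split. Qed.

Lemma eq_pairing c F G : F =1 G -> pairing c F = pairing c G.
Proof. by move=> FG; apply: eq_bigr => s _; apply: FG. Qed.

End Chains.

Lemma coboundary_map (T U : Type) (f : T -> U) (F : seq U -> bool) s :
  coboundary F (map f s) = coboundary (F \o map f) s.
Proof. by elim: s F => //= x s IH F; rewrite IH. Qed.

(** * Filling a cycle by means of a contraction *)

Section Filling.
Variable T : Type.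
Implicit Types (F : seq T -> bool) (z : seq (seq T)) (s : seq T).

(** Dual form of the chain homotopy identity [dP + Pd = f + g] mod 2. The induction runs over all
    [F], because splitting off the first vertex replaces [F] by [F \o cons (f x)]. *)
Lemma prism_homotopy (f g : T -> T) F s :
  pairing (prism f g s) (coboundary F)
    (+) coboundary (fun r => pairing (prism f g r) F) s
  = F (map f s) (+) F (map g s).
Proof.
elim: s F => [|x s IH] F /=.
  by rewrite pairing_nil addbF addbb.
rewrite !pairing_cons !pairing_map /=.
have -> : coboundary (fun r => pairing
      ([:: f x, g x & map g r] :: map (cons (f x)) (prism f g r)) F) s
    = coboundary (F \o cons (f x) \o cons (g x)) (map g s) (+)
      coboundary (fun r => pairing (prism f g r) (F \o cons (f x))) s.
  rewrite coboundary_map -coboundaryD; apply: eq_coboundary => r.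
  by rewrite pairing_cons pairing_map.
rewrite (@eq_pairing _ _ (coboundary F \o cons (f x))
  (fun r => F r (+) coboundary (F \o cons (f x)) r)) // pairingD.
have xorE (a b c d e h i : bool) : a (+) b = c (+) d ->
    (e (+) (d (+) h)) (+) (i (+) a) (+) (i (+) (h (+) b)) = c (+) e.
  by case: a b c d e h i => [] [] [] [] [] [] [].
exact: xorE (IH _).
Qed.

(* The cycle z is pushed to the point a by the stages k 0 = id, ..., k K = a of
   a contraction, and the result is coned off. *)
Definition fill (K : nat) (k : nat -> T -> T) (a : T) z : seq (seq T) :=
  flatten [seq flatten [seq prism (k m) (k m.+1) s | s <- z] | m <- iota 0 K]
  ++ [seq a :: map (k K) s | s <- z].

(** The boundaries of the prisms telescope to [z] plus its last stage; the cone contributes that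
    last stage again, plus the cone over the boundary of the cycle, which is zero. *)
Lemma coboundary_fill K k a z F : (forall x, k 0 x = x) ->
  (forall G, pairing z (coboundary G) = false) ->
  pairing (fill K k a z) (coboundary F) = pairing z F.
Proof.
move=> k0 zcycle; rewrite pairing_cat.
have step m : pairing (flatten [seq prism (k m) (k m.+1) s | s <- z]) (coboundary F)
    = pairing z (F \o map (k m)) (+) pairing z (F \o map (k m.+1)).
  rewrite pairing_flatten -pairingD.
  rewrite -[LHS]addbF -(zcycle (fun r => pairing (prism (k m) (k m.+1) r) F)).
  by rewrite -pairingD; apply: eq_pairing => s; rewrite prism_homotopy.
have -> : pairing (flatten [seq flatten [seq prism (k m) (k m.+1) s | s <- z]
      | m <- iota 0 K]) (coboundary F) = pairing z F (+) pairing z (F \o map (k K)).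
  elim: K => [|K IH].
    rewrite /= pairing_nil (@eq_pairing _ z (F \o map (k 0)) F) ?addbb // => s /=.
    by congr F; rewrite (eq_map k0) map_id.
  rewrite -{1}addn1 iotaD map_cat flatten_cat pairing_cat IH /= cats0 step.
  by rewrite addbA addbK.
have -> : pairing [seq a :: map (k K) s | s <- z] (coboundary F)
    = pairing z (fun s => (F \o map (k K)) s
        (+) coboundary ((F \o cons a) \o map (k K)) s).
  rewrite pairing_map; apply: eq_pairing => s.
  by rewrite -coboundary_map.
by rewrite pairingD zcycle addbF addbK.
Qed.

End Filling.

(** * Alternating words and labelled simplices *)

Fixpoint alternating (b : bool) (w : seq bool) : bool :=
  if w is x :: w' then (x == b) && alternating (~~ b) w' else true.

(** A nonempty alternating word has exactly one deletion that leaves an alternating word starting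
    with [b]: the last letter if it starts with [b], the first one otherwise. In any other word such
    deletions come in pairs, from two equal neighbours. *)
Lemma coboundary_alternating b w :
  coboundary (alternating b) w = alternating true w (+) alternating false w.
Proof.
elim: w b => [|x w IH] b //=.
have -> : coboundary (fun r => (x == b) && alternating (~~ b) r) w
   = (x == b) && coboundary (alternating (~~ b)) w.
  by case: (x == b) => //=; elim: w {IH} => //= y w ->.
rewrite IH.
by case: x b => [] [] /=; case: (alternating true w); case: (alternating false w).
Qed.

Lemma eq_coboundary_in (T : eqType) (F G : seq T -> bool) s :
  (forall r, subseq r s -> F r = G r) -> coboundary F s = coboundary G s.
Proof.
elim: s F G => [//|x s IH] F G FG.
apply: (congr2 addb); first by apply: FG; apply: subseq_cons.
by apply: IH => r rs; apply: FG; rewrite /= eqxx.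
Qed.

Lemma coboundary_rem (T : eqType) (F : seq T -> bool) s :
  (forall r r', perm_eq r r' -> F r = F r') ->
  coboundary F s = \big[addb/false]_(x <- s) F (rem x s).
Proof.
elim: s F => [|x s IH] F Fperm; first by rewrite big_nil.
rewrite big_cons /= eqxx IH => [|r r' rr']; last first.
  by apply: Fperm; rewrite perm_cons.
congr (_ (+) _); rewrite !big_seq; apply: eq_bigr => y ys.
case: eqP => // <-{y} in ys *; apply: Fperm.
by rewrite perm_sym perm_to_rem.
Qed.

(** Up to order, deleting a position is deleting a value. This permits sorting the vertices of a
    simplex by label. *)
Lemma coboundary_perm (T : eqType) (F : seq T -> bool) s s' :
  (forall r r', perm_eq r r' -> F r = F r') ->
  perm_eq s s' -> coboundary F s = coboundary F s'.
Proof.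
move=> Fperm ss'; rewrite !coboundary_rem // (perm_big _ ss') /=.
rewrite !big_seq; apply: eq_bigr => x xs'; apply: Fperm.
rewrite -(perm_cons x) -(permPr (perm_to_rem xs')) perm_sym.
by rewrite -(permPl ss') perm_to_rem // (perm_mem ss').
Qed.

(** A label is an index with a sign. Comparing signs at equal indices makes the order antisymmetric,
    so that sorting is canonical. *)
Definition label_le (u v : nat * bool) : bool :=
  (u.1 < v.1) || (u.1 == v.1) && (u.2 ==> v.2).

Lemma label_le_trans : transitive label_le.
Proof.
move=> [b y] [a x] [c z]; rewrite /label_le /=.
case/orP=> [ab|/andP[/eqP-> xy]]; case/orP=> [bc|/andP[/eqP<- yz]].
- by rewrite (ltn_trans ab bc).
- by rewrite ab.
- by rewrite bc.
- by rewrite eqxx orbC; case: x y z xy yz => [] [] [].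
Qed.

Lemma label_le_total : total label_le.
Proof.
move=> [a x] [b y]; rewrite /label_le /=.
by case: ltngtP => //= _; case: x y => [] [].
Qed.

Lemma label_le_anti : antisymmetric label_le.
Proof.
move=> [a x] [b y]; rewrite /label_le /=.
by case: ltngtP => //= ->; case: x y => [] [].
Qed.

(* Ky Fan's count of alternating simplices. *)
Definition fan (b : bool) (l : seq (nat * bool)) : bool :=
  alternating b (map snd (sort label_le l)).

Lemma fan_perm b r r' : perm_eq r r' -> fan b r = fan b r'.
Proof.
move=> rr'; congr (alternating _ (map _ _)).
by apply/perm_sortP => //; [apply: label_le_total|apply: label_le_trans|apply: label_le_anti].
Qed.

(** Faces of a sorted list are sorted, so the claim reduces to words of signs. *)
Lemma coboundary_fan b l : coboundary (fan b) l = fan true l (+) fan false l.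
Proof.
have sl := sort_sorted label_le_total l.
rewrite (@coboundary_perm _ _ l (sort label_le l)); last 2 first.
- exact: fan_perm.
- by rewrite perm_sym perm_sort.
rewrite (@eq_coboundary_in _ _ (alternating b \o map snd)) => [|r rs].
  by rewrite -coboundary_map coboundary_alternating.
rewrite /fan /= sorted_sort //; first exact: label_le_trans.
exact: subseq_sorted label_le_trans _ _ rs sl.
Qed.

Definition flip (u : nat * bool) := (u.1, ~~ u.2).

(** Ky Fan's hypothesis that no edge carries opposite labels. *)
Definition consistent (l : seq (nat * bool)) : Prop :=
  forall u v, u \in l -> v \in l -> u.1 = v.1 -> u.2 = v.2.

Lemma alternating_flip b w : alternating b (map negb w) = alternating (~~ b) w.
Proof. by elim: w b => //= x w IH b; rewrite IH; case: x b => [] []. Qed.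

(** Flipping could only disturb the order among labels of equal index, and by consistency these are
    equal. *)
Lemma fan_flip b l : consistent l -> fan b (map flip l) = fan (~~ b) l.
Proof.
move=> cl; rewrite /fan -alternating_flip; congr alternating.
rewrite -map_comp (_ : sort _ (map flip l) = map flip (sort label_le l)).
  by rewrite -map_comp.
apply: (sorted_eq label_le_trans label_le_anti).
- exact: sort_sorted label_le_total _.
- rewrite sorted_map; apply: (sub_in_sorted (P := mem l) (e := label_le)).
  + move=> u v ul vl; rewrite /label_le /=.
    case/orP=> [-> //|/andP[/eqP uv1 _]]; rewrite uv1.
    by rewrite eqxx (cl u v) // implybb orbT.
  + by apply/allP => u; rewrite mem_sort.
  + exact: sort_sorted label_le_total _.
- rewrite perm_sort perm_map // perm_sym perm_sort //.
Qed.

(** Along a sorted alternating list consecutive signs differ, so by consistency the indices increase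
    strictly; there are only [M] of them. *)
Lemma fan_size b l M : consistent l -> {in l, forall u, u.1 < M} ->
  M < size l -> fan b l = false.
Proof.
move=> cl lM sl; apply/negP => al.
have {al} : sorted ltn (map fst (sort label_le l)).
  have : {subset sort label_le l <= l} by move=> u; rewrite mem_sort.
  have := sort_sorted label_le_total l; move: al; rewrite /fan.
  elim: (sort _ l) b => //= u [|v s] //= IH b.
  move=> /andP[/eqP ub /andP[/eqP vb al]] /andP[uv pv] sub.
  rewrite (IH (~~ b)) ?andbT //= ?vb ?eqxx //; last first.
    by move=> w ws; apply: sub; rewrite inE ws orbT.
  case/orP: uv => // /andP[/eqP uv _].
  have := cl u v (sub _ _) (sub _ _) uv; rewrite ub vb !inE !eqxx orbT.
  by case: (b) => /(_ isT isT).
move=> /(sorted_uniq ltn_trans ltnn) ul.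
suff /(uniq_leq_size ul) : {subset map fst (sort label_le l) <= iota 0 M}.
  by rewrite size_map size_sort size_iota leqNgt sl.
by move=> _ /mapP[u + ->]; rewrite mem_sort mem_iota => /lM.
Qed.

Lemma mem_prism (T : eqType) (f g : T -> T) s s' : s' \in prism f g s ->
  size s' = (size s).+1 /\ {in s', forall y, exists2 x, x \in s & y = f x \/ y = g x}.
Proof.
elim: s s' => //= x s IH s'; rewrite inE => /predU1P[->|/mapP[r /IH[sr fg] ->]].
  split=> [|y]; first by rewrite /= size_map.
  rewrite !inE => /predU1P[->|/predU1P[->|/mapP[z zs ->]]].
  - by exists x; rewrite ?mem_head //; left.
  - by exists x; rewrite ?mem_head //; right.
  - by exists z; rewrite ?inE ?zs ?orbT //; right.
split=> [|y]; first by rewrite /= sr.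
rewrite inE => /predU1P[->|/fg[z zs yz]].
  by exists x; rewrite ?mem_head //; left.
by exists z; rewrite // inE zs orbT.
Qed.

(** * Chains carried by products of cells, and the parity of their alternating simplices *)

Section CellChains.
Variables (T : eqType) (t1 t2 : T -> T).
Hypotheses (t1K : involutive t1) (t2K : involutive t2).
Hypothesis t12 : forall x, t1 (t2 x) = t2 (t1 x).
Variables (K : nat) (k : nat -> nat -> nat -> T -> T) (a : nat -> nat -> T).
Hypothesis k0 : forall p q x, k p q 0 x = x.

(* cell p q is a fine chain representing the product of the p-cell of the first
   sphere with the q-cell of the second one, each sphere having two cells per
   dimension, exchanged by the antipodes t1 and t2.  The empty tuple makes the
   complexes augmented. *)
Fixpoint cell (p : nat) : nat -> seq (seq T) :=
  fix cellp (q : nat) : seq (seq T) :=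
    fill K (k p q) (a p q)
      ((if p is p'.+1 then cell p' q ++ map (map t1) (cell p' q) else [::])
       ++ (if q is q'.+1 then cellp q' ++ map (map t2) (cellp q') else [::])
       ++ (if (p == 0) && (q == 0) then [:: [::]] else [::])).

Arguments cell : simpl never.

(** The cycle that [cell p q] fills: mod 2, [(1 + t1)] applied to the [(p-1, q)] cell plus
    [(1 + t2)] applied to the [(p, q-1)] cell; in dimension zero it is the empty tuple of the
    augmentation. *)
Definition cell_boundary (p q : nat) : seq (seq T) :=
  (if p is p'.+1 then cell p' q ++ map (map t1) (cell p' q) else [::])
  ++ (if q is q'.+1 then cell p q' ++ map (map t2) (cell p q') else [::])
  ++ (if (p == 0) && (q == 0) then [:: [::]] else [::]).

Lemma cellE p q : cell p q = fill K (k p q) (a p q) (cell_boundary p q).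
Proof. by case: p q => [|p] [|q]. Qed.

Lemma pairing_cell_boundary p q F : pairing (cell_boundary p q) F =
  (if p is p'.+1 then pairing (cell p' q) F (+) pairing (cell p' q) (F \o map t1)
   else false)
  (+) (if q is q'.+1 then
         pairing (cell p q') F (+) pairing (cell p q') (F \o map t2) else false)
  (+) ((p == 0) && (q == 0) && F [::]).
Proof.
rewrite !pairing_cat addbA; congr (_ (+) _ (+) _).
- by case: p => [|p]; rewrite ?pairing_nil // pairing_cat pairing_map.
- by case: q => [|q]; rewrite ?pairing_nil // pairing_cat pairing_map.
- by case: andb; rewrite ?pairing_cons pairing_nil ?addbF.
Qed.

(** By induction on [p + q], [cell_boundary p q] is a cycle: [(1 + t)^2 = 0] mod 2 for an involution
    [t], and the mixed terms [(1 + t1)(1 + t2)] occur twice since [t1] and [t2] commute. *)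
Lemma coboundary_cell p q F :
  pairing (cell p q) (coboundary F) = pairing (cell_boundary p q) F.
Proof.
have [n pqn] := ubnP (p + q).
elim: n => // n IH in p q F pqn *.
rewrite cellE coboundary_fill // => {}F.
have mapK c (t : T -> T) G : involutive t ->
    pairing c (G \o map t \o map t) = pairing c G.
  move=> tK; apply: eq_pairing => s /=.
  by rewrite -map_comp (eq_map (g := id)) ?map_id.
have mapC c G : pairing c (G \o map t2 \o map t1) = pairing c (G \o map t1 \o map t2).
  by apply: eq_pairing => s /=; rewrite -!map_comp; congr G; apply: eq_map => x /=.
have {}IH p' q' (t : T -> T) : p' + q' < n ->
    pairing (cell p' q') (coboundary F) (+) pairing (cell p' q') (coboundary F \o map t)
    = pairing (cell_boundary p' q') F (+) pairing (cell_boundary p' q') (F \o map t).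
  move=> p'q'; rewrite -!IH //; congr (_ (+) _); apply: eq_pairing => s.
  by rewrite /= coboundary_map.
rewrite pairing_cell_boundary.
case: p q pqn => [|p] [|q] pqn //=; rewrite ?addSn ?addnS ?addn0 ?add0n !ltnS in pqn.
- rewrite IH // !pairing_cell_boundary /=.
  by case: q pqn => [|q] _ /=; rewrite ?addbb // !mapK //; do !case: (pairing _ _).
- rewrite IH ?addn0 // !pairing_cell_boundary /=.
  by case: p pqn => [|p] _ /=; rewrite ?addbb // !mapK //; do !case: (pairing _ _).
rewrite !IH ?addnS // 1?ltnW // !pairing_cell_boundary /= !andbF !addbF.
have mapK1 c G := mapK c t1 G t1K; have mapK2 c G := mapK c t2 G t2K.
case: p q pqn => [|p] [|q] _ /=; rewrite ?(mapK1, mapK2) ?mapC /=;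
  by do !case: (pairing _ _).
Qed.

Variables (p0 q0 : nat) (C : nat -> nat -> T -> Prop) (near : nat -> T -> T -> Prop).
Hypothesis C_apex : forall p q, C p q (a p q).
Hypothesis C_k : forall p q m x, p <= p0 -> q <= q0 -> m <= K ->
  C p q x -> C p q (k p q m x).
Hypothesis C_face1 : forall p q x, C p q x -> C p.+1 q x /\ C p.+1 q (t1 x).
Hypothesis C_face2 : forall p q x, C p q x -> C p q.+1 x /\ C p q.+1 (t2 x).
Hypothesis kK : forall p q x, k p q K x = a p q.
Hypothesis near_apex : forall r p q, near r (a p q) (a p q).
Hypothesis near_t1 : forall r x y, near r x y -> near r (t1 x) (t1 y).
Hypothesis near_t2 : forall r x y, near r x y -> near r (t2 x) (t2 y).
Hypothesis near_k : forall r p q m m' x y, m <= K -> m' <= K ->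
  m <= m'.+1 -> m' <= m.+1 ->
  C p q x -> C p q y -> near r x y -> near r.+1 (k p q m x) (k p q m' y).

(** [C p q] is the closed product cell, and the index [r] of [near r] counts fillings. A prism joins
    two consecutive stages of the contraction, so each filling costs one unit of closeness. *)
Lemma mem_cell p q s : p <= p0 -> q <= q0 -> s \in cell p q ->
  [/\ size s = (p + q).+1, {in s, forall x, C p q x} &
      {in s &, forall x y, near (p + q).+1 x y}].
Proof.
have [n pqn] := ubnP (p + q).
elim: n => // n IH in p q s pqn *; move=> pp0 qq0.
have bd s' : s' \in cell_boundary p q ->
   [/\ size s' = p + q, {in s', forall x, C p q x} &
      {in s' &, forall x y, near (p + q) x y}].
  rewrite !mem_cat => /or3P[].
  - case: p pqn pp0 => // p; rewrite addSn ltnS => pqn /ltnW pp0.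
    rewrite mem_cat => /orP[|/mapP[r rc ->]]; [move=> rc|]; have [sr Cr nr] := IH _ _ _ pqn pp0 qq0 rc.
      by split=> // x /Cr /C_face1[].
    split=> [|_ /mapP[x xr ->]|_ _ /mapP[x xr ->] /mapP[y yr ->]].
    - by rewrite size_map.
    - by have /C_face1[] := Cr _ xr.
    - exact/near_t1/nr.
  - case: q pqn qq0 => // q; rewrite addnS ltnS => pqn /ltnW qq0.
    rewrite mem_cat => /orP[|/mapP[r rc ->]]; [move=> rc|]; have [sr Cr nr] := IH _ _ _ pqn pp0 qq0 rc.
      by split=> // x /Cr /C_face2[].
    split=> [|_ /mapP[x xr ->]|_ _ /mapP[x xr ->] /mapP[y yr ->]].
    - by rewrite size_map.
    - by have /C_face2[] := Cr _ xr.
    - exact/near_t2/nr.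
  - by case: andP => // -[/eqP-> /eqP->]; rewrite inE => /eqP->.
rewrite cellE mem_cat => /orP[/flatten_mapP[m]|/mapP[r /bd[sr Cr nr] ->]].
  rewrite mem_iota add0n => mK /flatten_mapP[r /bd[sr Cr nr]] /mem_prism[ss sk].
  rewrite ss sr; split=> // [y /sk[x xr yx]|y y' /sk[x xr yx] /sk[x' xr' yx']].
    by case: yx => ->; apply: C_k; rewrite // ?(ltnW mK) //; apply: Cr.
  by case: yx => ->; case: yx' => ->; apply: near_k;
    rewrite // ?(ltnW mK) ?leqnSn //; do [exact: ltnW|exact: Cr|exact: nr].
(* The last stage of the contraction is constant, hence the simplices of the cone are degenerate. *)
have aK : {in a p q :: map (k p q K) r, forall x, x = a p q}.
  by move=> x; rewrite inE => /predU1P[//|/mapP[y _ ->]].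
split; first by rewrite /= size_map sr.
- by move=> x /aK->.
- by move=> x y /aK-> /aK->.
Qed.

Variable lam : T -> nat * bool.
Hypothesis lam_t1 : forall x p q, p <= p0 -> q <= q0 -> C p q x ->
  lam (t1 x) = flip (lam x).
Hypothesis lam_t2 : forall x p q, p <= p0 -> q <= q0 -> C p q x ->
  lam (t2 x) = flip (lam x).
Hypothesis lam_near : forall x y p q r, p <= p0 -> q <= q0 -> C p q x -> C p q y ->
  r <= (p0 + q0).+1 -> near r x y ->
  (lam x).1 = (lam y).1 -> (lam x).2 = (lam y).2.

Lemma consistent_cell p q s : p <= p0 -> q <= q0 -> s \in cell p q ->
  consistent (map lam s).
Proof.
move=> pp0 qq0 /(mem_cell pp0 qq0)[_ Cs ns] _ _ /mapP[x xs ->] /mapP[y ys ->].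
apply: (lam_near pp0 qq0 (Cs _ xs) (Cs _ ys) _ (ns _ _ xs ys)).
by rewrite ltnS leq_add.
Qed.

(** The sum of the two fans is the coboundary of [fan true], so the count moves to the boundary.
    There the antipodal copy of a face turns [fan true] into [fan false], and the two faces together
    give the count of a smaller cell: Pascal's rule, started by the empty tuple. *)
Lemma fan_cell p q : p <= p0 -> q <= q0 ->
  pairing (cell p q) (fun s => fan true (map lam s) (+) fan false (map lam s))
  = odd 'C(p + q, p).
Proof.
have [n pqn] := ubnP (p + q).
elim: n => // n IH in p q pqn *; move=> pp0 qq0.
have flipP (t : T -> T) p' q' : (forall x p q, p <= p0 -> q <= q0 -> C p q x ->
     lam (t x) = flip (lam x)) -> p' <= p0 -> q' <= q0 ->
  pairing (cell p' q') ((fan true \o map lam) \o map t)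
   = pairing (cell p' q') (fan false \o map lam).
  move=> lam_t p'p0 q'q0; rewrite /pairing !big_seq; apply: eq_bigr => s sc /=.
  rewrite -[false]/(~~ true) -fan_flip; last exact: consistent_cell sc.
  congr fan; rewrite -!map_comp; apply/eq_in_map => x xs /=.
  by have [_ Cs _] := mem_cell p'p0 q'q0 sc; apply: lam_t (Cs _ xs).
transitivity (pairing (cell p q) (coboundary (fan true \o map lam))).
  by apply: eq_pairing => s; rewrite -coboundary_map coboundary_fan.
rewrite coboundary_cell pairing_cell_boundary.
case: p q pqn pp0 qq0 => [|p] [|q] pqn pp0 qq0 /=; rewrite ?addSn ?addnS ?addn0 ?add0n ?ltnS in pqn.
- by [].
- by rewrite (flipP t2) ?(ltnW qq0) // -pairingD IH ?(ltnW qq0) // !bin0.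
- by rewrite (flipP t1) ?(ltnW pp0) // -pairingD IH ?addn0 ?(ltnW pp0) // !binn.
rewrite (flipP t1) ?(ltnW pp0) // (flipP t2) ?(ltnW qq0) // -!pairingD.
rewrite !IH ?addnS ?(ltnW pp0) ?(ltnW qq0) // 1?ltnW // addbF.
by rewrite addbC ?addSn [in RHS]binS oddD.
Qed.

(** A top simplex has [p0 + q0 + 1] vertices; with at most [p0 + q0] indices none of them is
    alternating, and the count would be even. *)
Lemma odd_bin_labels M : (forall x p q, p <= p0 -> q <= q0 -> C p q x -> (lam x).1 < M) ->
  odd 'C(p0 + q0, p0) -> p0 + q0 < M.
Proof.
move=> lamM; rewrite -(fan_cell (leqnn _) (leqnn _)); apply: contraTltn => Mpq.
rewrite /pairing big_seq big1 // => s sc.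
have [ss Cs _] := mem_cell (leqnn _) (leqnn _) sc; have cs := consistent_cell (leqnn _) (leqnn _) sc.
have ls : {in map lam s, forall u, u.1 < M}.
  by move=> _ /mapP[x xs ->]; apply: lamM (Cs _ xs).
by rewrite !(fan_size _ cs ls) // size_map ss ltnS.
Qed.

End CellChains.

Local Open Scope classical_set_scope.
Local Open Scope ring_scope.

(** * Maps odd in each variable on products of spheres *)

Section OctahedralSphere.
Variables (R : realType) (n : nat).
Implicit Types x : 'rV[R]_n.+1.

(** The octahedral sphere replaces the round one because its cells contract to their poles along
    straight segments, without normalisation. *)
Definition l1norm x : R := \sum_j `|x 0 j|.

Lemma l1normN x : l1norm (- x) = l1norm x.
Proof. by apply: eq_bigr => j _; rewrite mxE normrN. Qed.

Lemma norm_le_l1norm x : `|x| <= l1norm x.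
Proof.
rewrite /Num.norm /= mx_normrE; apply/bigmax_leP; split=> [|[i j] _ /=].
  exact: sumr_ge0.
by rewrite ord1 /l1norm (bigD1 j) //= lerDl sumr_ge0.
Qed.

Lemma continuous_l1norm : continuous l1norm.
Proof.
rewrite /l1norm; apply: continuous_big => [|j _ x]; first exact: add_continuous.
exact: (continuous_comp (@coord_continuous R 1 n.+1 0 j x) (@norm_continuous R R^o _)).
Qed.

Lemma compact_l1sphere : compact [set x | l1norm x = 1].
Proof.
apply: bounded_closed_compact.
  exists 1; split=> // M M1 x /= x1.
  by apply: le_trans (ltW M1); rewrite -x1 norm_le_l1norm.
apply: (@preimage_closed _ _ l1norm [set x | x = 1]) => [x _|]; last exact: closed_eq.
exact: continuous_l1norm.
Qed.

(** For [p > n] the default of [inord] gives the coordinate 0, which is harmless: the sign and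
    vanishing conditions of [hemisphere p] are then void. *)
Definition pole (p : nat) : 'rV[R]_n.+1 := delta_mx 0 (inord p).

Definition hemisphere (p : nat) x : Prop := l1norm x = 1 /\
  forall j : 'I_n.+1, ((p < j)%N -> x 0 j = 0) /\ (j = p :> nat -> 0 <= x 0 j).

Lemma hemisphere_pole p : hemisphere p (pole p).
Proof.
split.
  rewrite /l1norm (bigD1 (inord p)) //= mxE !eqxx normr1 big1 ?addr0 // => j jp.
  by rewrite mxE (negPf jp) andbF normr0.
move=> j; split=> [pj|_]; rewrite mxE /= ?ler0n //.
case: eqP => // jp; have /ltn_trans/(_ (ltn_ord j)) pn := pj.
by rewrite jp inordK ?ltnn in pj.
Qed.

Lemma hemisphere_norm p x : hemisphere p x -> `|x| <= 1.
Proof. by move=> [<- _]; apply: norm_le_l1norm. Qed.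

(** On the smaller cell the coordinate [p + 1] vanishes, so its sign condition holds for [x] and
    [- x] alike. *)
Lemma hemisphere_face p x : hemisphere p x ->
  hemisphere p.+1 x /\ hemisphere p.+1 (- x).
Proof.
move=> [x1 xp]; split; split; rewrite ?l1normN // => j.
  by split=> [/ltnW/(xp j).1//|jp]; rewrite (xp j).1 ?jp.
split=> [/ltnW/(xp j).1 xj|jp]; first by rewrite mxE xj oppr0.
by rewrite mxE (xp j).1 ?jp ?oppr0.
Qed.

(** The coordinate [p] of [x] is nonnegative, so no cancellation occurs and the l1 norm is affine
    along the segment. *)
Lemma hemisphere_convex p x t : (p <= n)%N -> 0 <= t <= 1 -> hemisphere p x ->
  hemisphere p ((1 - t) *: x + t *: pole p).
Proof.
move=> pn /andP[t0 t1] [x1 xp]; have t1' : 0 <= 1 - t by rewrite subr_ge0.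
have jE (j : 'I_n.+1) : ((1 - t) *: x + t *: pole p) 0 j
    = (1 - t) * x 0 j + t * (j == p :> nat)%:R.
  by rewrite !mxE eqxx -val_eqE /= inordK.
split; last first.
  move=> j; rewrite jE; split=> [pj|jp].
    by rewrite (xp j).1 // (gtn_eqF pj) !mulr0 addr0.
  by rewrite addr_ge0 ?mulr_ge0 ?(xp j).2.
rewrite /l1norm (eq_bigr (fun j => (1 - t) * `|x 0 j| + t * (j == inord p)%:R)).
  rewrite big_split -!mulr_sumr /= -/(l1norm x) x1 mulr1.
  by rewrite (bigD1 (inord p)) //= eqxx big1 ?addr0 ?mulr1 ?subrK // => j /negPf->.
move=> j _; rewrite jE -(inj_eq val_inj) /= inordK //.
case: eqP => [jp|_]; last by rewrite !mulr0 !addr0 normrM ger0_norm.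
have xj := (xp j).2 jp.
by rewrite !mulr1 !ger0_norm // addr_ge0 ?mulr_ge0.
Qed.

End OctahedralSphere.

Arguments pole {R} n p.

(** * The Hopf-Stiefel obstruction *)

Section Biodd.
Variables (R : realType) (a b M : nat).
Local Notation point := ('rV[R]_a.+1 * 'rV[R]_b.+1)%type.
Variable Phi : point -> 'rV[R]_M.
Hypothesis Phi_cont : continuous Phi.
Hypothesis Phi_odd1 : forall x y, Phi (- x, y) = - Phi (x, y).
Hypothesis Phi_odd2 : forall x y, Phi (x, - y) = - Phi (x, y).

Let S : set point := [set x | l1norm x = 1] `*` [set y | l1norm y = 1].

Let compactS : compact S.
Proof. by apply: compact_setX; apply: compact_l1sphere. Qed.

Let SP p q : S (pole a p, pole b q).
Proof. by split=> /=; [case: (hemisphere_pole R a p)|case: (hemisphere_pole R b q)]. Qed.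

(** Compactness gives a minimum [d] of the norm and a uniform modulus [e] for the tolerance [d].
    Then a coordinate that is at least [d] in absolute value at two [e]-close points has the same
    sign at both. *)
Lemma uniform_gap : (forall z, S z -> Phi z <> 0) ->
  exists d e : R, [/\ 0 < d, 0 < e, forall z, S z -> d <= `|Phi z| &
     forall z w, S z -> `|z - w| < e -> `|Phi z - Phi w| < d].
Proof.
move=> Phi0.
have S0 : S !=set0 by exists (pole a 0, pole b 0).
have [|z0 Sz0 minz0] := compact_EVT_min S0 compactS (f := fun z => `|Phi z|).
  apply: continuous_subspaceT => z.
  exact: (continuous_comp (@Phi_cont z) (@norm_continuous R _ _)).
rewrite inE in Sz0.
have d0 : 0 < `|Phi z0| by rewrite normr_gt0; apply/eqP/Phi0.
exists `|Phi z0|.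
have : \forall e \near 0^'+, S `<=` [set z | forall w, `|z - w| < e -> `|Phi z - Phi w| < `|Phi z0|].
  apply: (compact_near_coveringP S).1 => // z Sz.
  have : Phi w @[w --> z] --> Phi z by apply: Phi_cont.
  move=> /cvgrPdist_lt /(_ (`|Phi z0| / 2)).
  rewrite divr_gt0 // => /(_ isT) /nbhs_ballP[r /= r0 rP].
  exists (ball z (r / 2), [set e | e < r / 2]) => /=.
    split; first by apply: nbhsx_ballx; rewrite divr_gt0.
    by apply: nbhs_right_lt; rewrite divr_gt0.
  move=> [z' e] /= [zz' er] w z'w.
  rewrite -(subrKA (Phi z)) (splitr `|Phi z0|).
  apply: le_lt_trans (ler_normD _ _) _; rewrite ltrD //.
    rewrite distrC; apply: rP; apply: le_ball zz'.
    by rewrite ler_pdivrMr // ler_peMr ?ltW // ltr1n.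
  apply: rP; rewrite -ball_normE /= in zz' *.
  rewrite -(subrKA z') (splitr r).
  by apply: le_lt_trans (ler_normD _ _) _; rewrite ltrD // (lt_trans z'w).
move=> /(filterI (nbhs_right_gt 0)) /filter_ex[e [e0 eP]].
exists e; split=> // z Sz; last by move=> w; apply: eP.
by apply: minz0; rewrite inE.
Qed.

Let C p q (z : point) := hemisphere p z.1 /\ hemisphere q z.2.
Let apex p q : point := (pole a p, pole b q).

Let C_norm p q z : C p q z -> `|z| <= 1.
Proof.
by case: z => x y [/hemisphere_norm x1 /hemisphere_norm y1]; rewrite prod_normE ge_max x1.
Qed.

Let C_S p q z : C p q z -> S z.
Proof. by case: z => x y [[x1 _] [y1 _]]. Qed.

(** Contracting by the same factor does not expand distances; changing the factor from [s] to [t]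
    moves [w] along a segment of length at most 2. *)
Lemma contraction_near (p q : nat) (s t : R) z w : 0 <= s <= 1 -> C p q w ->
  `|((1 - s) *: z + s *: apex p q) - ((1 - t) *: w + t *: apex p q)|
  <= `|z - w| + 2 * `|t - s|.
Proof.
move=> /andP[s0 s1] Cw.
have -> : ((1 - s) *: z + s *: apex p q) - ((1 - t) *: w + t *: apex p q)
    = (1 - s) *: (z - w) + (t - s) *: (w - apex p q).
  rewrite !scalerBr !scalerBl !scale1r.
  by apply/eqP; rewrite -subr_eq0; apply/eqP; case: z w Cw => [x y] [x' y'] _;
    congr pair; apply/rowP => j; rewrite !mxE; ring.
apply: le_trans (ler_normD _ _) _; rewrite !normrZ lerD //.
  by rewrite ler_piMl // ger0_norm ?subr_ge0 // lerBlDr lerDl.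
rewrite mulrC ler_wpM2r // (le_trans (ler_normB _ _)) // (_ : 2 = 1 + 1) //.
have Ca : C p q (apex p q) by split; apply: hemisphere_pole.
by rewrite lerD // ?(C_norm Cw) ?(C_norm Ca).
Qed.

(** A point is labelled by a coordinate of [Phi] that is large there, with its sign. Oddness makes
    the labels antipodal, the uniform gap makes them consistent on fine simplices, and only [M]
    indices exist. *)
Lemma biodd_nonvanishing : (forall z, S z -> Phi z <> 0) ->
  odd 'C(a + b, a) -> (a + b < M)%N.
Proof.
move=> /uniform_gap[d [e [d0 e0 Phi_d Phi_e]]].
(* At most [a + b + 1] fillings are nested, and each adds at most [2 / K] to the distances. *)
have [K [K0 Ke]] : exists K : nat, 0 < K%:R :> R /\ (a + b).+1%:R * (2 / K%:R) < e.
  exists (Num.truncn ((a + b).+1%:R * 2 / e)).+1; split; first by rewrite ltr0n.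
  by rewrite mulrA ltr_pdivrMr ?ltr0n // -ltr_pdivrMl // mulrC truncnS_gt.
pose frac m : R := m%:R / K%:R.
have frac01 m : (m <= K)%N -> 0 <= frac m <= 1.
  by move=> mK; rewrite divr_ge0 //= ler_pdivrMr // mul1r ler_nat.
pose k p q m (z : point) : point := (1 - frac m) *: z + frac m *: apex p q.
pose close (r : nat) (z w : point) : Prop := `|z - w| <= r%:R * (2 / K%:R).
(* The default value is never reached on [S], by [lamP]. *)
pose lam (z : point) : nat * bool :=
  if [pick j | d <= `|Phi z 0 j|] is Some j then (val j, 0 < Phi z 0 j)
  else (0%N, true).
pose t1 (z : point) : point := (- z.1, z.2).
pose t2 (z : point) : point := (z.1, - z.2).
have lamP z : S z -> exists2 j : 'I_M, d <= `|Phi z 0 j| & lam z = (val j, 0 < Phi z 0 j).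
  move=> /Phi_d dz; rewrite /lam; case: pickP => [j dj|none]; first by exists j.
  have : mx_norm (Phi z) != 0 by rewrite gt_eqF // (lt_le_trans d0 dz).
  by move=> /mx_norm_neq0[[i j]] /=; rewrite ord1 => E; move: dz (none j); rewrite /Num.norm/= E => ->.
have lam_flip z w : S z -> Phi w = - Phi z -> lam w = flip (lam z).
  move=> /lamP[j dj lz] wz; rewrite /lam.
  have -> : [pick j | d <= `|Phi w 0 j|] = [pick j | d <= `|Phi z 0 j|].
    by apply: eq_pick => i; rewrite wz mxE normrN.
  move: lz; rewrite /lam; case: pickP => [i di _|/(_ j)]; last by rewrite dj.
  rewrite /flip /= wz mxE oppr_gt0 -leNgt le_eqVlt; congr (_, _).
  (* Negation reverses the sign bit only at a nonzero value, which the bound by [d] guarantees. *)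
  case: eqP => // Phi0; move: di; rewrite Phi0 normr0 => /(lt_le_trans d0).
  by rewrite ltxx.
have normt (t : point -> point) : (forall z w, t z - t w = t (z - w)) ->
    (forall z, `|t z| = `|z|) -> forall r z w, close r z w -> close r (t z) (t w).
  by move=> tB tn r z w; rewrite /close tB tn.
have t1n r z w : close r z w -> close r (t1 z) (t1 w).
  apply: normt => [[x y] [x' y']|[x y]].
    by congr pair => //=; rewrite opprD.
  by rewrite !prod_normE /= normrN.
have t2n r z w : close r z w -> close r (t2 z) (t2 w).
  apply: normt => [[x y] [x' y']|[x y]].
    by congr pair => //=; rewrite opprD.
  by rewrite !prod_normE /= normrN.
have CN p q z : C p q z -> (C p.+1 q z /\ C p.+1 q (t1 z)) /\ (C p q.+1 z /\ C p q.+1 (t2 z)).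
  case: z => x y [/= xp yq].
  have [xp1 xp1'] := hemisphere_face xp; have [yq1 yq1'] := hemisphere_face yq.
  by split; split; split.
apply: (@odd_bin_labels point t1 t2 _ _ _ K k apex _ a b C close _ _ _ _ _ _ _ _ _ lam).
- by move=> [x y]; rewrite /t1 /= opprK.
- by move=> [x y]; rewrite /t2 /= opprK.
- by [].
- by move=> p q z; rewrite /k /frac mul0r subr0 scale1r scale0r addr0.
- by move=> p q; split; apply: hemisphere_pole.
- move=> p q m [x y] pa qb /frac01 f01 [xp yq].
  by split; apply: hemisphere_convex.
- by move=> p q z /CN[].
- by move=> p q z /CN[].
- by move=> p q z; rewrite /k /frac divff ?gt_eqF // subrr scale0r add0r scale1r.
- by move=> r p q; rewrite /close subrr normr0 mulr_ge0 // divr_ge0 // ltW.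
- exact: t1n.
- exact: t2n.
- move=> r p q m m' z w mK m'K mm' m'm Cz Cw zw.
  have := contraction_near (frac m') z (frac01 _ mK) Cw.
  rewrite /close /k => /le_trans; apply.
  rewrite -[r.+1%:R]natr1 [leRHS]mulrDl mul1r lerD // ler_wpM2l // /frac -mulrBl normrM.
  rewrite [X in _ * X]ger0_norm ?invr_ge0 ?(ltW K0) // ler_piMl ?invr_ge0 ?(ltW K0) //.
  have : (m%:R <= m'%:R + 1 :> R) && (m'%:R <= m%:R + 1 :> R) by rewrite !natr1 !ler_nat mm'.
  by rewrite ler_norml; lra.
- move=> [x y] p q _ _ /C_S Sz; apply: lam_flip => //; exact: Phi_odd1.
- move=> [x y] p q _ _ /C_S Sz; apply: lam_flip => //; exact: Phi_odd2.
- move=> z w p q r _ _ /C_S Sz /C_S Sw rab zw.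
  have [i di ->] := lamP z Sz; have [j dj ->] /= := lamP w Sw.
  move=> /val_inj ij; subst j.
  (* Opposite signs would put the two values at least [2 * d] apart. *)
  have : `|Phi z 0 i - Phi w 0 i| < d.
    apply: le_lt_trans (Phi_e z w Sz _).
      rewrite [leRHS]/Num.norm /= mx_normrE; apply/bigmax_geP; right.
      by exists (0, i) => //=; rewrite !mxE.
    apply: le_lt_trans zw _; apply: le_lt_trans Ke.
    by rewrite ler_wpM2r ?divr_ge0 ?(ltW K0) // ler_nat.
  move: di dj; rewrite ltr_norml => + + /andP[].
  by case: (ltrP 0 (Phi z 0 i)) => zi; case: (ltrP 0 (Phi w 0 i)) => wi //;
    rewrite ?(gtr0_norm zi) ?(gtr0_norm wi) ?(ler0_norm zi) ?(ler0_norm wi); lra.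
- by move=> z p q _ _ /C_S /lamP[j _ ->] /=.
Qed.

End Biodd.

(** * Lower bound for the target dimension *)

Section MatrixContinuity.
Variables (R : realType) (T : topologicalType).

Lemma continuous_entriesP m n (F : T -> 'M[R]_(m, n)) :
  continuous F <-> forall i j, continuous (fun t => F t i j).
Proof.
split=> [Fc i j t|Fc t].
  exact: (continuous_comp (Fc t) (@coord_continuous R m n i j (F t))).
apply/cvgrPdist_lt => e e0.
near=> s.
rewrite [ltLHS]/Num.norm /= mx_normrE; apply/bigmax_ltP; split=> // ij _.
rewrite !mxE /=; move: ij; near: s; apply: filter_forall => -[i j] /=.
exact: ((@cvgrPdist_lt _ _ _ _ _ _ _).1 (Fc i j t) e e0).
Unshelve. all: by end_near. Qed.

Lemma continuous_sumr (I : Type) (r : seq I) (P : pred I) (F : I -> T -> R) :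
  (forall i, P i -> continuous (F i)) -> continuous (fun t => \sum_(i <- r | P i) F i t).
Proof. by apply: continuous_big; apply: add_continuous. Qed.

Lemma continuous_prodr (I : Type) (r : seq I) (P : pred I) (F : I -> T -> R) :
  (forall i, P i -> continuous (F i)) -> continuous (fun t => \prod_(i <- r | P i) F i t).
Proof. by apply: continuous_big; apply: mul_continuous. Qed.

Lemma continuous_mulmx m n p (F : T -> 'M[R]_(m, n)) (G : T -> 'M[R]_(n, p)) :
  continuous F -> continuous G -> continuous (fun t => F t *m G t).
Proof.
move=> /continuous_entriesP Fc /continuous_entriesP Gc.
apply/continuous_entriesP => i j.
rewrite (_ : (fun t => _) = fun t => \sum_k F t i k * G t k j); last first.
  by apply/funext => t; rewrite mxE.
apply: continuous_sumr => k _ t.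
by apply: continuousM; [apply: Fc|apply: Gc].
Qed.

Lemma continuous_det n (F : T -> 'M[R]_n) :
  continuous F -> continuous (fun t => \det (F t)).
Proof.
move=> /continuous_entriesP Fc.
rewrite (_ : (fun t => _) = fun t => \sum_(s : 'S_n) (-1) ^+ s * \prod_i F t i (s i)) //.
apply: continuous_sumr => s _ t.
apply: cvgM; first exact: cvg_cst.
by apply: continuous_prodr => i _; apply: Fc.
Qed.

Lemma continuous_adj n (F : T -> 'M[R]_n) :
  continuous F -> continuous (fun t => \adj (F t)).
Proof.
move=> /continuous_entriesP Fc; apply/continuous_entriesP => i j.
rewrite (_ : (fun t => _) = fun t => (-1) ^+ (j + i) * \det (row' j (col' i (F t)))); last first.
  by apply/funext => t; rewrite mxE.
move=> t; apply: cvgM; first exact: cvg_cst.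
apply: continuous_det; apply/continuous_entriesP => k l.
rewrite (_ : (fun t => _) = fun t => F t (lift j k) (lift i l)) //.
by apply/funext => s; rewrite !mxE.
Qed.

Lemma continuous_scalar_mx n (d : T -> R) :
  continuous d -> continuous (fun t => (d t)%:M : 'M[R]_n).
Proof.
move=> dc; apply/continuous_entriesP => i j.
rewrite (_ : (fun t => _) = fun t => d t *+ (i == j)); last first.
  by apply/funext => t; rewrite mxE.
by case: (i == j) => //; apply: cst_continuous.
Qed.

Lemma continuous_addmx m n (F G : T -> 'M[R]_(m, n)) :
  continuous F -> continuous G -> continuous (fun t => F t + G t).
Proof. by move=> Fc Gc t; apply: cvgD; [apply: Fc|apply: Gc]. Qed.

Lemma continuous_submx m n (F G : T -> 'M[R]_(m, n)) :
  continuous F -> continuous G -> continuous (fun t => F t - G t).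
Proof. by move=> Fc Gc t; apply: cvgB; [apply: Fc|apply: Gc]. Qed.

Lemma continuous_scalemx m n (d : T -> R) (F : T -> 'M[R]_(m, n)) :
  continuous d -> continuous F -> continuous (fun t => d t *: F t).
Proof. by move=> dc Fc t; apply: cvgZ; [apply: dc|apply: Fc]. Qed.

Lemma continuous_addr (g h : T -> R) :
  continuous g -> continuous h -> continuous (fun t => g t + h t).
Proof. by move=> gc hc t; apply: cvgD; [apply: gc|apply: hc]. Qed.

Lemma continuous_mulr (g h : T -> R) :
  continuous g -> continuous h -> continuous (fun t => g t * h t).
Proof. by move=> gc hc t; apply: cvgM; [apply: gc|apply: hc]. Qed.

Lemma continuous_comp_fun (U V : topologicalType) (F : U -> V) (g : T -> U) :
  continuous g -> continuous F -> continuous (F \o g).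
Proof. by move=> gc Fc t; apply: continuous_comp; [apply: gc|apply: Fc]. Qed.

Lemma continuous_cst (U : topologicalType) (c : U) : continuous (fun _ : T => c).
Proof. exact: cst_continuous. Qed.

End MatrixContinuity.

(** Total skewness as linear algebra: a relation with [t != 0] is a meeting point of two tangent
    lines, one with [t = 0] and [u], [v] nonzero is a parallelism. *)
Definition tangentially_free (R : realType) (n N : nat) (f : 'rV[R]_n -> 'rV[R]_N) : Prop :=
  forall x y (u v : 'rV[R]_n) t, x != y ->
  u *m jacobian f x + v *m jacobian f y + t *: (f x - f y) = 0 ->
  [/\ u = 0, v = 0 & t = 0].

Section LowerBound.
Variables (R : realType) (n N : nat) (f : 'rV[R]_n -> 'rV[R]_N).
Hypothesis f_cont : continuous f.
Hypothesis J_cont : continuous (jacobian f).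
Hypothesis tangent_free : tangentially_free f.
Local Notation J := (jacobian f).

(** [P] is a right inverse of [A] and [K] takes coordinates along a basis of the kernel of [P]. The
    size [r] is existential because it arises as a rank. *)
Lemma complement_projection (A : 'M[R]_(n, N)) : row_free A ->
  exists r (P : 'M[R]_(N, n)) (K : 'M[R]_(N, r)),
    [/\ r = (N - n)%N, A *m P = 1%:M & forall v : 'rV_N, v *m P = 0 -> v *m K = 0 -> v = 0].
Proof.
move=> Afree; pose P := pinvmx A; have AP : A *m P = 1%:M by apply: mulmxVp.
pose kb := row_base (kermx P).
exists (\rank (kermx P)), P, (pinvmx kb); split=> // [|v vP vK].
  rewrite mxrank_ker; congr (_ - _)%N; apply/eqP; rewrite eqn_leq rank_leq_col.
  by rewrite -[leqLHS](mxrank1 R n) -AP mxrankM_maxr.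
have /submxP[c vc] : (v <= kb)%MS by rewrite eq_row_base; apply/sub_kermxP.
by move: vK; rewrite vc -mulmxA mulmxVp ?row_base_free // mulmx1 => ->; rewrite mul0mx.
Qed.

(** Regroups a difference into the shape of [tangentially_free]. If both coefficients vanish, then
    [c] equals [d *: p] and its opposite, so [d *: p = 0]. *)
Lemma antipodal_combination (d s : R) (p c : 'rV[R]_n) (J1 J2 : 'M[R]_(n, N)) (g : 'rV[R]_N) :
  d *: (p *m (J1 - J2) + s *: g) - c *m (J1 + J2)
  = (d *: p - c) *m J1 + (- (d *: p) - c) *m J2 + (d * s) *: g.
Proof.
rewrite mulmxBr mulmxDr !mulmxBl mulNmx -!scalemxAl.
move: (p *m J1) (p *m J2) (c *m J1) (c *m J2) => a1 a2 a3 a4.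
by apply/rowP => j; rewrite !mxE; ring.
Qed.

Lemma skew_lower_bound i : (i < n)%N -> odd 'C(n + i, i) -> (2 * n + i < N)%N.
Proof.
move=> ltin oddC.
have [x0 x00] : exists x : 'rV[R]_n, 0 != x.
  exists (delta_mx 0 (Ordinal ltin)); rewrite eq_sym; apply/eqP => /rowP/(_ (Ordinal ltin)).
  by rewrite !mxE !eqxx => /eqP; rewrite oner_eq0.
have J0free : row_free (J 0).
  apply: inj_row_free => u uJ; have [] := tangent_free (u := u) (v := 0) (t := 0) x00.
    by rewrite uJ mul0mx scale0r !addr0.
  by [].
have [r [P [K [rE JP PK]]]] := complement_projection J0free.
have nN : (n <= N)%N by move: J0free; rewrite /row_free => /eqP <-; apply: rank_leq_col.
pose B (y : 'rV[R]_n) := J y + J (- y).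
have JN_cont : continuous (J \o -%R).
  by apply: continuous_comp_fun; first exact: opp_continuous.
have B_cont : continuous B by apply: (continuous_addmx J_cont JN_cont).
have BP_cont : continuous (fun y => B y *m P) by apply: continuous_mulmx => //; apply: continuous_cst.
pose D y := \det (B y *m P).
have D_cont : continuous D by apply: continuous_det.
(* [B 0] is twice [J 0], so [B 0 *m P] is twice the identity and stays invertible near 0. *)
have [eps [eps0 epsD]] : exists eps, 0 < eps /\ forall y, `|y| <= eps -> D y != 0.
  have D0 : D 0 != 0.
    by rewrite /D /B oppr0 mulmxDl JP -mulr2n -scaler_nat detZ det1 mulr1 expf_neq0 ?pnatr_eq0.
  have /cvgrPdist_lt/(_ `|D 0|) : D @ nbhs (0 : 'rV[R]_n) --> D 0 by apply: D_cont.
  rewrite normr_gt0 => /(_ D0) /nbhs_ballP[e /= e0 eP].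
  exists (e / 2); split=> [|y ye]; first by rewrite divr_gt0.
  apply/eqP => Dy; have := eP y; rewrite -ball_normE /= sub0r normrN Dy subr0 ltxx.
  move=> F; suff : false by []; apply: F; apply: le_lt_trans ye _.
  by rewrite ltr_pdivrMr // ltr_pMr // ltr1n.

(* Projection modulo the rows of [B y], scaled by the determinant [D y] so that the adjugate stands
   in for the inverse. *)
pose Q y := ((D y)%:M - P *m \adj (B y *m P) *m B y) *m K.
have Q_cont : continuous Q.
  apply: continuous_mulmx; last exact: continuous_cst.
  apply: continuous_submx; first exact: continuous_scalar_mx.
  apply: continuous_mulmx => //; apply: continuous_mulmx; first exact: continuous_cst.
  exact: continuous_adj.
pose pt (e : 'rV[R]_i.+1) : 'rV[R]_n := eps *: (e *m pid_mx i.+1).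
pose A y := J y - J (- y).
have A_cont : continuous A by apply: (continuous_submx J_cont JN_cont).
have fN_cont : continuous (f \o -%R).
  by apply: continuous_comp_fun; first exact: opp_continuous.
(* A point of the second sphere encodes the pair of the scalar [t], its coordinate 0, and the vector
   [tl u]. *)
pose tl (u : 'rV[R]_n.+1) : 'rV[R]_n := \row_j u 0 (lift ord0 j).
have ptN e : pt (- e) = - pt e by rewrite /pt mulNmx scalerN.
have AN y : A (- y) = - A y by rewrite /A opprK opprB.
have BN y : B (- y) = B y by rewrite /B opprK; apply: addrC.
have QN y : Q (- y) = Q y by rewrite /Q /D BN.
have tlN u : tl (- u) = - tl u by apply/rowP => j; rewrite !mxE.
pose Phi (z : 'rV[R]_i.+1 * 'rV[R]_n.+1) :=
  (tl z.2 *m A (pt z.1) + z.2 0 0 *: (f (pt z.1) - f (- pt z.1))) *m Q (pt z.1).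
suff : (i + n < r)%N by rewrite rE; lia.
have pt_cont : continuous (fun z : 'rV[R]_i.+1 * 'rV[R]_n.+1 => pt z.1).
  apply: continuous_scalemx; first exact: continuous_cst.
  by apply: continuous_mulmx; [move=> z; apply: cvg_fst|apply: continuous_cst].
have u_cont j : continuous (fun z : 'rV[R]_i.+1 * 'rV[R]_n.+1 => z.2 0 j).
  by apply: (continuous_comp_fun (F := fun u : 'rV[R]_n.+1 => u 0 j));
    [move=> z; apply: cvg_snd|apply: coord_continuous].
apply: (@biodd_nonvanishing R i n r Phi).
- apply: continuous_mulmx; last exact: (continuous_comp_fun pt_cont Q_cont).
  apply: continuous_addmx.
    apply: continuous_mulmx; last first.
      exact: (continuous_comp_fun pt_cont A_cont).
    apply/continuous_entriesP => i' j.
    rewrite [X in continuous X](_ : _ =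
        fun z : 'rV[R]_i.+1 * 'rV[R]_n.+1 => z.2 0 (lift ord0 j)).
      exact: u_cont.
    by apply/funext => z'; rewrite mxE.
  apply: continuous_scalemx; first exact: u_cont.
  exact: (continuous_comp_fun pt_cont (continuous_submx f_cont fN_cont)).
- move=> e u; rewrite /Phi [(- e, u).1]/= [(- e, u).2]/= ptN AN QN opprK mulmxN.
  by rewrite -[f (- pt e) - _]opprB scalerN -opprD mulNmx.
- move=> e u; rewrite /Phi [(e, - u).1]/= [(e, - u).2]/= tlN mulNmx mxE scaleNr.
  by rewrite -opprD mulNmx.
- move=> [e u] [/= e1 u1]; rewrite /Phi /=; set y := pt e; set v := _ + _ => vQ.
  have y0 : y != 0.
    apply/eqP => /eqP; rewrite scaler_eq0 (gt_eqF eps0) /=.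
    rewrite mulmx_free_eq0; last by rewrite /row_free rank_pid_mx.
    move=> /eqP e0; move: e1; rewrite e0 /l1norm big1 => [/eqP|j _].
      by rewrite eq_sym oner_eq0.
    by rewrite mxE normr0.
  have yN : y != - y by rewrite -subr_eq0 opprK -mulr2n -scaler_nat scaler_eq0 pnatr_eq0.
  have y_eps : `|y| <= eps.
    rewrite normrZ gtr0_norm // ler_piMr ?(ltW eps0) //.
    rewrite [leLHS]/Num.norm /= mx_normrE; apply/bigmax_leP; split=> // -[k j] _ /=.
    rewrite !mxE -e1; apply: le_trans (ler_norm_sum _ _ _) _; apply: ler_sum => l _.
    by rewrite ord1 normrM mxE ler_piMr // normr_nat lern1 leq_b1.
  have Dy := epsD y y_eps.
  (* A vector killed by [Q y] has its multiple by [D y] in the row space of [B y], with coefficients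
     [c]. *)
  pose c := v *m P *m \adj (B y *m P).
  have : D y *: v - c *m B y = 0.
    apply: PK.
      rewrite mulmxBl -scalemxAl -(mulmxA c) /c -(mulmxA (v *m P)).
      by rewrite mul_adj_mx mul_mx_scalar subrr.
    by move: vQ; rewrite /Q mulmxA mulmxBr mul_mx_scalar !mulmxA.
  rewrite /v /B /A antipodal_combination => /(tangent_free yN)[uc vc tc].
  have tl0 : tl u = 0.
    have : D y *: tl u = 0.
      move: uc vc => /subr0_eq <- /eqP; rewrite -opprD oppr_eq0 -mulr2n -scaler_nat.
      by rewrite scaler_eq0 pnatr_eq0 => /eqP.
    by move/eqP; rewrite scaler_eq0 (negPf Dy) => /eqP.
  have u00 : u 0 0 = 0 by move/eqP: tc; rewrite mulf_eq0 (negPf Dy) => /eqP.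
  move: u1; rewrite /l1norm big1 => [/eqP|j _]; first by rewrite eq_sym oner_eq0.
  apply/eqP; rewrite normr_eq0; case: (unliftP ord0 j) => [k ->|->]; last by rewrite u00.
  by move/rowP/(_ k): tl0; rewrite !mxE => ->.
- by rewrite addnC.
Qed.

End LowerBound.

(** * From tangent lines to linear algebra *)

Section TotallySkew.
Variables (R : realType) (n N : nat) (f : 'rV[R]_n -> 'rV[R]_N).

Hypothesis f_emb : C1_embedding_on [set: 'rV[R]_n] f.

Let f_diff x : differentiable f x.
Proof. by case: f_emb => /(_ x I)[]. Qed.

Let J_cont : continuous (jacobian f).
Proof. by move=> x; case: f_emb => /(_ x I)[]. Qed.

Let f_cont : continuous f.
Proof. by move=> x; apply: differentiable_continuous. Qed.

Let f_inj : injective f.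
Proof. by case: f_emb => _ _ [g [gK _]] x y /(congr1 g); rewrite !gK. Qed.

Let J_inj x (u : 'rV[R]_n) : u *m jacobian f x = 0 -> u = 0.
Proof.
case: f_emb => _ /(_ x I) inj _; rewrite /jacobian mul_rV_lin1 => u0.
by apply: inj; rewrite u0 linear0.
Qed.

(** The curve is the image of a straight line; its difference quotients are literally those of [f]
    along [u]. *)
Lemma tangent_vector_range x (u : 'rV[R]_n) : tangent_vector (range f) (f x) (u *m jacobian f x).
Proof.
pose gamma (s : R) := f (s *: u + x).
have quotientE t : (fun h : R => h^-1 *: ((gamma \o shift t) (h *: 1) - gamma t))
    = (fun h => h^-1 *: ((f \o shift (t *: u + x)) (h *: u) - f (t *: u + x))).
  by apply/funext => h; rewrite /gamma /= [h%:A](mulr1) scalerDl addrA.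
have gamma_derivable t : derivable gamma t 1.
  by rewrite /derivable quotientE; apply: diff_derivable.
have gammaE t : derive1 gamma t = u *m jacobian f (t *: u + x).
  by rewrite derive1E /derive quotientE -/(derive f _ u) deriveEjacobian.
exists gamma; split.
- by rewrite /gamma scale0r add0r.
- near=> t; split; [by exists (t *: u + x)|exact: gamma_derivable|].
  rewrite (_ : derive1 gamma = fun t => u *m jacobian f (t *: u + x)); last exact/funext.
  have line_cont : continuous (fun t : R => t *: u + x).
    apply: continuous_addmx; last exact: continuous_cst.
    by apply: continuous_scalemx => [t'|]; [apply: cvg_id|apply: continuous_cst].
  have u_cont : continuous (fun _ : R => u) by exact: continuous_cst.
  exact: (continuous_mulmx u_cont (continuous_comp_fun line_cont J_cont)).
- by rewrite gammaE scale0r add0r.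
Unshelve. all: by end_near. Qed.

(** If [t != 0], dividing by [t] exhibits a common point of two tangent lines; if [t = 0], the
    relation makes the lines parallel, unless [u] or [v] is zero, and then injectivity of the
    differential concludes. *)
Lemma totally_skew_tangentially_free : (0 < n)%N -> totally_skew n (range f) ->
  tangentially_free f.
Proof.
move=> n0 [_ skewP] x y u v t xy E.
have skew_xy (u' v' : 'rV[R]_n) : u' != 0 -> v' != 0 ->
    Defs.skew (line (f x) (u' *m jacobian f x)) (line (f y) (v' *m jacobian f y)).
  move=> u0 v0; apply: (skewP (f x) (f y)); rewrite ?(inj_eq f_inj) //; try by eexists.
    exists (u' *m jacobian f x); split=> //; first exact: tangent_vector_range.
    by apply: contra_neq u0 => /J_inj.
  exists (v' *m jacobian f y); split=> //; first exact: tangent_vector_range.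
  by apply: contra_neq v0 => /J_inj.
have [w0 w00] : exists w : 'rV[R]_n, w != 0.
  exists (delta_mx 0 (Ordinal n0)); apply/eqP => /rowP/(_ (Ordinal n0)).
  by rewrite !mxE !eqxx => /eqP; rewrite oner_eq0.
have t0 : t = 0.
  apply/eqP/negP => t0'.
  (* a zero direction is replaced by an arbitrary one, used with parameter 0 *)
  pose dir (z : 'rV[R]_n) := if z == 0 then w0 else z.
  have dir0 z : dir z != 0 by rewrite /dir; case: (eqVneq z 0).
  have dirE z A : exists s : R, s *: (dir z *m A) = t^-1 *: (z *m A) :> 'rV[R]_N.
    rewrite /dir; case: (eqVneq z 0) => [->|_]; last by exists t^-1.
    by exists 0; rewrite scale0r mul0mx scaler0.
  have [s sE] := dirE u (jacobian f x); have [s' s'E] := dirE (- v) (jacobian f y).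
  have [_] := skew_xy _ _ (dir0 u) (dir0 (- v)).
  apply/eqP/set0P; exists (f x + s *: (dir u *m jacobian f x)); split; first by exists s.
  exists s'; first by [].
  rewrite sE s'E mulNmx.
  move: E; move: (u *m _) (v *m _) => a b E.
  have tn : t != 0 by apply/negP.
  apply: (scalerI tn); apply/eqP; rewrite -subr_eq0 -oppr_eq0 -{}E; apply/eqP.
  rewrite !scalerDr scalerN !scalerN !scalerA divff; last exact: tn.
  by apply/rowP => j; rewrite !mxE; ring.
move: E; rewrite t0 scale0r addr0 => E.
have [u0|u0] := eqVneq u 0.
  by split=> //; apply: (@J_inj y); rewrite -E u0 mul0mx add0r.
have [v0|v0] := eqVneq v 0.
  by split=> //; apply: (@J_inj x); rewrite -E v0 mul0mx addr0.
have [npar _] := skew_xy _ _ u0 v0; case: npar.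
rewrite /parallel; have -> : v *m jacobian f y = - (u *m jacobian f x).
  by apply/eqP; rewrite -addr_eq0 addrC E.
(* The directions are opposite, so the translation reverses the parameter. *)
move: (u *m _) => a; exists (f y - f x).
apply/seteqP; split=> [_ [s _ <-]|_ [_ [s _ <-] <-]].
  exists (f x + (- s) *: a); first by exists (- s).
  by rewrite addrA subrK scaleNr scalerN.
exists (- s); first by [].
by rewrite addrA subrK scaleNr scalerN opprK.
Qed.

End TotallySkew.

(** * Existence of totally skew embeddings *)

Section MonomialEmbedding.
Variables (R : realType) (n : nat).
Local Notation I := ('I_n + 'I_n * 'I_n + 'I_n)%type.
Local Notation V := 'rV[R]_n.

(** Coordinates, their pairwise products and their cubes. Only the existence of some target
    dimension is sought, so nothing is economised. *)
Definition monomial (k : I) (x : V) : R :=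
  match k with
  | inl (inl i) => x 0 i
  | inl (inr (i, j)) => x 0 i * x 0 j
  | inr i => x 0 i * x 0 i * x 0 i
  end.

Definition dmonomial (k : I) (x u : V) : R :=
  match k with
  | inl (inl i) => u 0 i
  | inl (inr (i, j)) => u 0 i * x 0 j + x 0 i * u 0 j
  | inr i => 3 * x 0 i * x 0 i * u 0 i
  end.

Definition monomials (x : V) : 'rV[R]_#|{: I}| := \row_k monomial (enum_val k) x.

Lemma differentiable_monomial k x : differentiable (monomial k) x.
Proof.
have dcoord i : differentiable (fun x : V => x 0 i) x by apply: differentiable_coord.
case: k => [[i|[i j]]|i] /=; first exact: dcoord.
- exact: differentiableM.
- by apply: differentiableM; first exact: differentiableM.
Qed.

Lemma derive_coord (i : 'I_n) (x u : V) : 'D_u (fun x : V => x 0 i) x = u 0 i.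
Proof.
have did : derivable (id : V -> V) x u by exact: derivable_id.
have := derive_mx did.
by rewrite derive_id => /matrixP/(_ 0 i); rewrite mxE.
Qed.

Lemma derive_monomial k x u : 'D_u (monomial k) x = dmonomial k x u.
Proof.
have dcoord i : derivable (fun x : V => x 0 i) x u.
  by apply: diff_derivable; apply: differentiable_coord.
case: k => [[i|[i j]]|i] /=; first exact: derive_coord.
- rewrite (deriveM (dcoord i) (dcoord j)) !derive_coord /GRing.scale /=; ring.
- rewrite (deriveM (derivableM (dcoord i) (dcoord i)) (dcoord i)).
  rewrite (deriveM (dcoord i) (dcoord i)) !derive_coord /GRing.scale /=.
  by rewrite -[_ x]/(x 0 i * x 0 i); ring.
Qed.

Lemma differentiable_monomials x : differentiable monomials x.
Proof.
have -> : monomials = \sum_k (fun x => monomial (enum_val k) x *: delta_mx 0 k).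
  apply/funext => y; rewrite fct_sumE [LHS]row_sum_delta.
  by apply: eq_bigr => k _; rewrite mxE.
apply: differentiable_sum => k.
by apply: differentiableZl; apply: differentiable_monomial.
Qed.

Lemma diff_monomials x u : 'd monomials x u = \row_k dmonomial (enum_val k) x u.
Proof.
have df := differentiable_monomials x.
rewrite -deriveE // derive_mx; last exact: diff_derivable.
apply/rowP => k; rewrite [LHS]mxE [RHS]mxE -derive_monomial.
rewrite (_ : (fun t => _) = monomial (enum_val k)) //.
by apply/funext => y; rewrite mxE.
Qed.

Lemma mul_jacobian_monomials x (u : V) :
  u *m jacobian monomials x = \row_k dmonomial (enum_val k) x u.
Proof. by rewrite mul_rV_lin1 diff_monomials. Qed.

Lemma continuous_jacobian_monomials : continuous (jacobian monomials).
Proof.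
have coord_cont i : continuous (fun x : V => x 0 i) by apply: coord_continuous.
apply/continuous_entriesP => a k.
rewrite [X in continuous X](_ : _ = fun x => dmonomial (enum_val k) x (delta_mx 0 a)); last first.
  by apply/funext => x; rewrite mxE diff_monomials mxE.
case: (enum_val k) => [[i|[i j]]|i] /=; first exact: continuous_cst.
- by apply: continuous_addr; apply: continuous_mulr => //; apply: continuous_cst.
- apply: continuous_mulr; last exact: continuous_cst.
  by do 2 (apply: continuous_mulr => //); apply: continuous_cst.
Qed.

Definition linear_part (w : 'rV[R]_#|{: I}|) : V :=
  \row_i w 0 (enum_rank (inl (inl i) : I)).

Lemma monomialsK : cancel monomials linear_part.
Proof. by move=> x; apply/rowP => i; rewrite !mxE enum_rankK. Qed.

Lemma linear_part_diff x u : linear_part ('d monomials x u) = u.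
Proof. by rewrite diff_monomials; apply/rowP => i; rewrite !mxE enum_rankK. Qed.

Lemma C1_embedding_monomials : C1_embedding_on [set: V] monomials.
Proof.
split.
- move=> x _; split; first exact: differentiable_monomials.
  exact: continuous_jacobian_monomials.
- by move=> x _ u v /(congr1 linear_part); rewrite !linear_part_diff.
- exists linear_part; split=> [x _|]; first exact: monomialsK.
  apply: continuous_subspaceT; apply/continuous_entriesP => a i.
  rewrite [X in continuous X](_ : _ = fun w : 'rV[R]_#|{: I}| =>
      w 0 (enum_rank (inl (inl i) : I))).
    exact: coord_continuous.
  by apply/funext => w; rewrite mxE.
Qed.

(** In a coordinate [j] where [x] and [y] differ, the powers 1, 2 and 3 already force [t], [u 0 j]
    and [v 0 j] to vanish; the products with the coordinate [j] then settle all the others. *)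
Lemma tangentially_free_monomials : tangentially_free monomials.
Proof.
move=> x y u v t xy.
rewrite !mul_jacobian_monomials => E.
have eqn k : dmonomial k x u + dmonomial k y v + t * (monomial k x - monomial k y) = 0.
  by move/rowP/(_ (enum_rank k)): E; rewrite !mxE !enum_rankK.
have /rV0Pn[j] : x - y != 0 by rewrite subr_eq0.
rewrite !mxE => xyj.
have := (eqn (inl (inl j)), eqn (inl (inr (j, j))), eqn (inr j)).
rewrite /=; set a := x 0 j; set b := y 0 j => -[[e1 e2] e3].
have ab : a - b != 0 by [].
have t0 : t = 0.
  (* the cubic with derivative 6(s - a)(s - b) *)
  have : t * (a - b) ^+ 3 = 0.
    transitivity (- (2 * (3 * a * a * u 0 j + 3 * b * b * v 0 j + t * (a * a * a - b * b * b))
      - 3 * (a + b) * (u 0 j * a + a * u 0 j + (v 0 j * b + b * v 0 j) + t * (a * a - b * b))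
      + 6 * (a * b) * (u 0 j + v 0 j + t * (a - b)))); first by ring.
    by rewrite e1 e2 e3 !mulr0 subrr addr0 oppr0.
  by move/eqP; rewrite mulf_eq0 expf_eq0 (negPf ab) orbF => /eqP.
have uj : u 0 j = 0.
  have : u 0 j * (a - b) = 0.
    by move: e1 e2; rewrite t0 !mul0r !addr0 => e1 e2; nra.
  by move/eqP; rewrite mulf_eq0 (negPf ab) orbF => /eqP.
have vj : v 0 j = 0 by move: e1; rewrite t0 uj mul0r addr0 add0r.
have uv0 k : u 0 k = 0 /\ v 0 k = 0.
  have := (eqn (inl (inl k)), eqn (inl (inr (k, j)))) => /= -[].
  rewrite uj vj t0 !mul0r !mulr0 !addr0 => k1 k2.
  have uk : u 0 k * (a - b) = 0 by rewrite /a /b; nra.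
  move/eqP: uk; rewrite mulf_eq0 (negPf ab) orbF => /eqP uk.
  by split=> //; move: k1; rewrite uk add0r.
by split=> //; apply/rowP => k; rewrite mxE; case: (uv0 k).
Qed.

(** Tangent vectors come from arbitrary curves in the image. Such a curve lifts through
    [linear_part], and the chain rule applies to the lift. *)
Lemma tangent_vector_monomials x w : tangent_vector (range monomials) (monomials x) w ->
  exists u, w = u *m jacobian monomials x.
Proof.
move=> [gamma [gamma0 gamma_near gammaw]].
pose delta t := linear_part (gamma t).
have gammaE : \forall t \near (0 : R), gamma t = (monomials \o delta) t.
  by apply: filterS gamma_near => t [[y _ yE] _ _]; rewrite /= /delta -yE monomialsK.
have [_ dgamma _] := nbhs_singleton gamma_near.
have ddelta : differentiable delta (0 : R).
  apply/derivable1_diffP/derivable_mxP => a i.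
  rewrite [X in derivable X](_ : _ = fun t => gamma t 0 (enum_rank (inl (inl i) : I))).
    exact: (derivable_mxP _ _ _).1.
  by apply/funext => t; rewrite mxE.
have delta0 : delta 0 = x by rewrite /delta gamma0 monomialsK.
exists ('d delta (0 : R) 1).
have dmon : differentiable monomials (delta 0) by apply: differentiable_monomials.
rewrite -gammaw derive1E (near_eq_derive _ gammaE) deriveE; last exact: differentiable_comp.
by rewrite diff_comp //= delta0 mul_rV_lin1.
Qed.

Lemma totally_skew_monomials : totally_skew n (range monomials).
Proof.
split.
  move=> p [x _ xp]; exists setT, setT, monomials; split=> //; try exact: openT.
  - exact: C1_embedding_monomials.
  - by rewrite setIT.
move=> p q L1 L2 [x _ <-] [y _ <-] xy [v [/tangent_vector_monomials[v' vE] v0 ->]]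
  [w [/tangent_vector_monomials[w' wE] w0 ->]].
have {}xy : x != y by apply: contra_neq xy => ->.
split.
  (* The points of parameters 0 and 1 on the second line are translates of points of the first, so
     [w] is a multiple of [v]. *)
  move=> [z zE].
  have : line (monomials y) w (monomials y) by exists 0 => //; rewrite scale0r addr0.
  have : line (monomials y) w (monomials y + w) by exists 1 => //; rewrite scale1r.
  rewrite zE => -[_ [s _ <-] Es] [_ [s' _ <-] Es'].
  have : ((s' - s) *: v') *m jacobian monomials x + w' *m jacobian monomials y
      + 0 *: (monomials x - monomials y) = 0.
    rewrite scale0r addr0 -scalemxAl -vE -wE.
    have -> : w = (monomials y + w) - monomials y by rewrite addrC addKr.
    by rewrite -Es -Es'; apply/rowP => k; rewrite !mxE; ring.
  by move/(tangentially_free_monomials xy) => [_ w'0 _]; move: w0; rewrite wE w'0 mul0mx eqxx.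
rewrite -subset0 => _ [[s _ <-] [s' _ E]].
have : (s *: v') *m jacobian monomials x + (- s' *: w') *m jacobian monomials y
      + 1 *: (monomials x - monomials y) = 0.
  rewrite scale1r -!scalemxAl -vE -wE.
  by move/rowP: E => E; apply/rowP => k; move: (E k); rewrite !mxE => Ek; lra.
by move/(tangentially_free_monomials xy) => [_ _ /eqP]; rewrite oner_eq0.
Qed.

End MonomialEmbedding.

(** * Parity of binomial coefficients and the final arithmetic *)

Lemma even_bin_exp2 s k : (0 < k < 2 ^ s)%N -> ~~ odd 'C(2 ^ s, k).
Proof.
case: k => // k /= ks; apply/negP => oddC.
have cop : coprime (2 ^ s) 'C(2 ^ s, k.+1) by rewrite coprimeXl // coprime2n.
(* From [2^s * C(2^s - 1, k) = (k + 1) * C(2^s, k + 1)]. *)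
have : (2 ^ s %| k.+1)%N by rewrite -(Gauss_dvdl _ cop) -mul_bin_diag dvdn_mulr.
by move/dvdn_leq => /(_ isT); rewrite leqNgt ks.
Qed.

(** By Pascal's rule, neighbouring coefficients of the row [2^s - 1] add up to an even one, so all
    have the parity of the first. *)
Lemma odd_bin_exp2_pred s k : (k < 2 ^ s)%N -> odd 'C((2 ^ s).-1, k).
Proof.
elim: k => [|k IH] ks; first by rewrite bin0.
have := @even_bin_exp2 s k.+1; rewrite ks -(prednK (expn_gt0 2 s)) => /(_ isT).
by rewrite binS oddD IH 1?ltnW // addbT negbK.
Qed.

(** The monomial embedding shows that the default value of [skew_dim] is not what gets taken. *)
Lemma skew_dim_admits (R : realType) n : admits_totally_skew_embedding R n (skew_dim R n).
Proof.
have ex : exists N, `[< admits_totally_skew_embedding R n N >].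
  exists #|{: 'I_n + 'I_n * 'I_n + 'I_n}|; apply/asboolP.
  by exists (@monomials R n); split; [apply: C1_embedding_monomials|apply: totally_skew_monomials].
have [N /asboolP NE Nmin] := ex_minnP ex.
have /(xgetPex 0%N)[] // : [set N | admits_totally_skew_embedding R n N /\
    forall k, admits_totally_skew_embedding R n k -> (N <= k)%N] !=set0.
by exists N; split=> // k kE; apply: Nmin; apply/asboolP.
Qed.

Lemma skew_dim_lower_bound (R : realType) n i : (i < n)%N -> odd 'C(n + i, i) ->
  (2 * n + i < skew_dim R n)%N.
Proof.
move=> ltin oddC; have [f [f_emb f_skew]] := skew_dim_admits R n.
have n0 : (0 < n)%N by apply: leq_ltn_trans ltin.
have [f_C1 _ _] := f_emb.
apply: (@skew_lower_bound R n _ f) => //.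
- move=> x; apply: differentiable_continuous; exact: (f_C1 x I).1.
- by move=> x; exact: (f_C1 x I).2.
- exact: totally_skew_tangentially_free.
Qed.

Theorem corollary1p6 (R : realType) :
  (forall (n : nat) (q m : int) (r : nat),
     (1 <= n)%N ->
     (skew_dim R n)%:Z = 2 * n%:Z + q ->
     q <= n%:Z ->
     n%:Z + q = 2 ^+ r + m ->
     0 <= m < 2 ^+ r ->
     [/\ m < q,
         2 ^+ r - q <= n%:Z <= 2 ^+ r - 1 &
         forall l : nat, n = (2 ^ l)%N -> q = n%:Z]) /\
  (forall l : nat, (3 * 2 ^ l <= skew_dim R (2 ^ l))%N).
Proof.
split=> [n q m r n1 Nq qn nqr /andP[m0 mr]|l].
  have r2 : 2 ^+ r = (2 ^ r)%N%:Z by rewrite -[RHS]natz natrX.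
  rewrite r2 in nqr mr *.
  have q1 : 0 < q.
    have := @skew_dim_lower_bound R n 0 n1; rewrite bin0 => /(_ isT); lia.
  have mq : m < q.
    (* Otherwise [2^r <= n < 2^(r+1)], and [i = 2^(r+1) - 1 - n] is below [n] with
       [n + i = 2^(r+1) - 1]. The bound then gives [n + q >= 2^(r+1)], against [m < 2^r]. *)
    rewrite ltNge; apply/negP => qm.
    have rn : (2 ^ r <= n)%N by lia.
    have nr : (n < 2 ^ r.+1)%N by rewrite expnS; lia.
    have := @skew_dim_lower_bound R n (2 ^ r.+1 - n.+1).
    rewrite (_ : (n + (2 ^ r.+1 - n.+1))%N = (2 ^ r.+1).-1); last by lia.
    rewrite odd_bin_exp2_pred; last by lia.
    have -> : (2 ^ r.+1 - n.+1 < n)%N by rewrite expnS; lia.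
    move=> /(_ isT isT); rewrite expnS; lia.
  split=> // [|l nl]; first by lia.
  (* If [q < n], then [2^r] would lie strictly between [2^l] and [2^(l+1)]. *)
  apply/eqP; rewrite eq_le qn leNgt; apply/negP => qln.
  have rl : (2 ^ r < 2 ^ l.+1)%N by rewrite expnS -nl; lia.
  have lr : (2 ^ l < 2 ^ r)%N by rewrite -nl; lia.
  by move: rl lr; rewrite !ltn_exp2l // ltnS leqNgt => /negP.
have l0 := expn_gt0 2 l; rewrite /= in l0.
(* The largest admissible [i], for which [n + i = 2^(l+1) - 1]. *)
have := @skew_dim_lower_bound R (2 ^ l) (2 ^ l).-1.
rewrite (_ : (2 ^ l + (2 ^ l).-1)%N = (2 ^ l.+1).-1); last by rewrite expnS; lia.
rewrite odd_bin_exp2_pred; last by rewrite expnS; lia.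
have -> : ((2 ^ l).-1 < 2 ^ l)%N by lia.
by move=> /(_ isT isT); lia.
Qed.
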